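(* Fix $L>0$, $b>0$, $W>0$. For $0<\gamma<\frac{\pi}{2}$ put $R_0=\frac{L}{\sin\gamma}$ and $R_1=R_0+b$, and let ${\mathcal E}(\gamma)$ be the geometric optics approximation to the Casimir energy between the infinite horizontal plate and the finite plate of width $W$, inclined at angle $\gamma$, lying between radial distances $R_0$ and $R_1$ from the origin. Then in the parallel plate limit $$\lim_{\gamma\to0^+}{\mathcal E}(\gamma)=-\frac{\hbar c\,\pi^2 A}{1440\,L^3},$$ where $A=bW$ is the area of the finite plate and $L$ is the separation between the plates.
   Context: $\hbar,c>0$ are constants. By translation invariance along the intersection line of the two planes, work in the planar wedge $\{(R\sin\psi,R\cos\psi):R>0,\ \frac{\pi}{2}-\gamma\le\psi\le\frac{\pi}{2}\}$, $(R,\psi)$ polar coordinates with $\psi$ measured from the vertical; it is bounded by the horizontal ray ($\psi=\frac{\pi}{2}$) and the inclined ray ($\psi=\frac{\pi}{2}-\gamma$). A closed $n$-bounce path starting at a point $p$ of the wedge is a piecewise straight path inside the wedge starting at $p$, undergoing exactly $n$ successive specular reflections off the two bounding rays (not at the vertex), and ending at $p$. For $m\ge1$ let ${\mathcal D}_{2m}$ be the set of $(R,\psi)$, with $R>0$ and $\frac{\pi}{2}-\gamma<\psi<\frac{\pi}{2}$, for which there is a closed $2m$-bounce path starting at $(R\sin\psi,R\cos\psi)$ whose first reflection is off the horizontal ray and all of whose reflections off the inclined ray occur at points at distance between $R_0$ and $R_1$ from the origin (i.e. on the finite plate). Let $l_{2m}(R,\psi)$ be the length of this path. The optical approximation to the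 Dirichlet Casimir energy is $-\frac{\hbar c}{2\pi^2}\sum_n(-1)^n\iiint_{{\mathcal D}_n}\frac{\sqrt{\Delta_n}}{l_n^3}d^3x$, where for plane boundaries $\Delta_n=l_n^{-2}$; odd-bounce contributions are excluded and each even-bounce closed path is counted twice (two directions), so that $${\mathcal E}(\gamma)=-\frac{\hbar c}{2\pi^2}\sum_{m\ge1}2W\iint_{{\mathcal D}_{2m}}\frac{1}{l_{2m}(R,\psi)^4}\,R\,dR\,d\psi .$$ *)

(* Defs.v *)
From HB Require Import structures.
From mathcomp Require Import all_boot all_order all_algebra.
From mathcomp Require Import all_classical all_reals all_analysis.

Set Implicit Arguments.
Unset Strict Implicit.
Unset Printing Implicit Defensive.

Import Order.TTheory GRing.Theory Num.Theory.
Import numFieldNormedType.Exports.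

Local Open Scope classical_set_scope.
Local Open Scope ring_scope.

Section Wedge.
Context {R : realType}.
Implicit Types (gamma r psi : R) (p v : R * R) (q : nat -> R * R).

(* psi is measured from the vertical, so psi = pi / 2 is the horizontal ray. *)
Definition polar r psi : R * R := (r * sin psi, r * cos psi).

Definition edot p v : R := p.1 * v.1 + p.2 * v.2.

(* The library norm on R * R is the sup norm, hence this Euclidean one. *)
Definition enorm p : R := Num.sqrt (edot p p).

Definition edir p v : R * R := (enorm (v - p))^-1 *: (v - p).

Definition wedge gamma : set (R * R) :=
  [set p | exists r psi,
    [/\ 0 < r, pi / 2 - gamma <= psi <= pi / 2 & p = polar r psi]].

Definition open_wedge gamma : set (R * R) :=
  [set p | exists r psi,
    [/\ 0 < r, pi / 2 - gamma < psi < pi / 2 & p = polar r psi]].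

Inductive side := Horizontal | Inclined.

Definition side_angle gamma (s : side) : R :=
  if s is Horizontal then pi / 2 else pi / 2 - gamma.

Definition ray gamma (s : side) : set (R * R) :=
  [set p | exists2 r, 0 < r & p = polar r (side_angle gamma s)].

Definition normal gamma (s : side) : R * R :=
  (cos (side_angle gamma s), - sin (side_angle gamma s)).

Definition reflect_dir gamma (s : side) v : R * R :=
  v - (2 * edot v (normal gamma s)) *: normal gamma s.

(* A closed n-bounce path from p is given by its vertices q 0, ..., q n.+1
   (later values of q are irrelevant), q 1, ..., q n being the reflection
   points.  The open segments lie in the open wedge, so that the path meets the
   rays exactly at these n points (and possibly at p); since the rays exclude
   the origin, no reflection is at the vertex. *)
Definition closed_bounce_path gamma (n : nat) p q : Prop :=
  [/\ wedge gamma p, q 0%N = p, q n.+1 = p,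
      forall k, (k <= n)%N -> q k != q k.+1 /\
        (forall t, 0 < t < 1 ->
           open_wedge gamma ((1 - t) *: q k + t *: q k.+1)) &
      forall k, (k < n)%N -> exists s : side, ray gamma s (q k.+1) /\
        edir (q k.+1) (q k.+2) = reflect_dir gamma s (edir (q k) (q k.+1))].

Definition plate_path gamma (R0 R1 : R) (n : nat) p q : Prop :=
  [/\ closed_bounce_path gamma n p q,
      ray gamma Horizontal (q 1%N) &
      forall k, (k < n)%N -> ray gamma Inclined (q k.+1) ->
        R0 <= enorm (q k.+1) <= R1].

Definition path_length (n : nat) q : R :=
  \sum_(k < n.+1) enorm (q k.+1 - q k).

(* The set D_{2m}, in the coordinates z = (R, psi). *)
Definition bounce_domain gamma (R0 R1 : R) (m : nat) : set (R * R) :=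
  [set z | [/\ 0 < z.1, pi / 2 - gamma < z.2 < pi / 2 &
    exists q, plate_path gamma R0 R1 (2 * m) (polar z.1 z.2) q]].

(* The length l_{2m} of the path in the definition of D_{2m}; the value is
   immaterial outside D_{2m}. *)
Definition bounce_length gamma (R0 R1 : R) (m : nat) (z : R * R) : R :=
  xget 0 [set l | exists2 q,
    plate_path gamma R0 R1 (2 * m) (polar z.1 z.2) q &
    l = path_length (2 * m) q].

(* Extended-real valued: neither the convergence of the integrals nor that of
   the series is built into the definition. *)
Definition casimir_energy (hbar c L b W gamma : R) : \bar R :=
  let R0 := L / sin gamma in
  let R1 := R0 + b in
  ((- (hbar * c / (2 * pi ^+ 2)))%:E *
   \sum_(1 <= m <oo)
     ((2 * W)%:E *
      \int[lebesgue_measure \x lebesgue_measure]_(z in bounce_domain gamma R0 R1 m)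
         (1 / bounce_length gamma R0 R1 m z ^+ 4 * z.1)%:E))%E.

End Wedge.

(* Main.v *)
Require Import Defs.
From HB Require Import structures.
From mathcomp Require Import all_boot all_order all_algebra.
From mathcomp Require Import all_classical all_reals all_analysis.
From mathcomp Require Import ring lra zify.
Import Order.TTheory GRing.Theory Num.Theory.
Import numFieldNormedType.Exports.
Local Open Scope classical_set_scope.
Local Open Scope ring_scope.

(** Unfolding. Reflect the wedge instead of the path at every bounce. A closed
    2m-bounce path from p, at distance r from the vertex, becomes a straight
    segment from p to the image of p under the rotation of angle 2 m gamma.
    Both ends are at distance r, so the path exists only if m gamma < pi / 2,
    it is unique, its length is 2 r sin (m gamma), its line is at distance
    r cos (m gamma) from the vertex, and the bounces are at the distances
    r cos (m gamma) / cos a, where a runs through angles of step gamma with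
    |a| <= m gamma. [billiard_path_plate] is the existence half and
    [closed_path_shape] the uniqueness half. Instead of composing reflections,
    the proofs follow two quantities along the path: the angle of the foot of
    the perpendicular from the vertex ([foot]), and the unfolded angle under
    which a bounce is seen from that foot, which grows by gamma at each
    bounce.

    The integral. The integrand is 1 / (16 r^3 sin^4 (m gamma)), and its
    domain is only compared with two rectangles in (r, psi). For fixed m, both
    have height gamma and a width that tends to b, while r is close to
    L / gamma; so the integral over either tends to b / (16 L^3 m^4). The
    distances of the bounces vary by factors 1 + O(gamma^2), which matters
    because R0 is of order 1 / gamma: the resulting changes of width are
    O(gamma). Rectangles and constant bounds on the integrand are therefore
    enough, and no antiderivative is computed.

    The series. The upper bound is m^-4 times a factor independent of m,
    thanks to y^2 cos y <= sin^2 y ([sqr_mul_cos_le_sin2]). So the limit of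
    the series is squeezed between finite sums and b zeta(4) / (16 L^3),
    without dominated convergence. Finally zeta(4) = pi^4 / 90 is obtained
    from cos^2 y / sin^4 y <= y^-4 <= 1 / sin^4 y, summed over the angles
    k pi / 2N with N a power of 2, where the cosecant sums satisfy a doubling
    recurrence ([zeta4_sum_dyadic]). *)

(** * Elementary trigonometric estimates *)

Section Trigonometry.
Context {R : realType}.
Implicit Types x y : R.

(** Both inequalities come from one use of the mean value theorem, since the
    cosine decreases from 1 on this interval. *)
Lemma sin_mean_value y : 0 <= y <= pi / 2 -> y * cos y <= sin y <= y.
Proof.
case/andP=> y0 y1.
have [x] := @MVT_segment R sin cos 0 y y0 (fun x _ => is_derive_sin x)
  (continuous_subspaceT (@continuous_sin R)).
rewrite in_itv/= sin0 !subr0 => /andP[x0 xy] ->.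
have pi2 : 0 < pi / 2 :> R by rewrite divr_gt0// pi_gt0.
apply/andP; split; last by rewrite ler_piMl// cos_le1.
rewrite mulrC ler_wpM2r//.
have [->//|xny] := eqVneq x y.
by rewrite ltW// ltr_cos ?in_itv/=; lra.
Qed.

Lemma cos_gt0_acute {y} : 0 <= y < pi / 2 -> 0 < cos y.
Proof. by move=> /andP[? ?]; apply: cos_gt0_pihalf; have := pi_gt0 R; lra. Qed.

(** Sharper than squaring [y * cos y <= sin y]. It follows from
    [z * cos z <= sin z] at the half angle z, the excess being a square. It is
    exactly what bounds [cos y ^+ 2 / sin y ^+ 4] by [y ^- 4], both in the
    evaluation of zeta(4) and, uniformly in m, in the Casimir series. *)
Lemma sqr_mul_cos_le_sin2 y : 0 <= y <= pi / 2 -> y ^+ 2 * cos y <= sin y ^+ 2.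
Proof.
move=> /andP[y0 y1]; set z := y / 2.
have -> : y = z *+ 2 by rewrite /z mulr2n; lra.
have z0 : 0 <= z by rewrite /z; lra.
have /sin_mean_value/andP[zc _] : 0 <= z <= pi / 2 by rewrite /z; lra.
rewrite sin_mulr2n cos_mulr2n; have s2 := sin2cos2 z.
set s := sin z in zc s2 *; set c := cos z in zc s2 *.
have c0 : 0 <= c by apply: cos_ge0_pihalf; rewrite /z; have := pi_gt0 R; lra.
have : (z * c) ^+ 2 <= s ^+ 2 by rewrite ler_sqr ?nnegrE ?mulr_ge0//; nra.
rewrite s2 => h.
have -> : (c * s *+ 2) ^+ 2 = 4 * c ^+ 2 * (1 - c ^+ 2) by rewrite -s2; ring.
have c1 : c <= 1 := cos_le1 _.
have h1 : c ^+ 2 * (z * c) ^+ 2 <= c ^+ 2 * (1 - c ^+ 2).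
  by rewrite ler_wpM2l ?sqr_ge0.
have -> : (z *+ 2) ^+ 2 * (c ^+ 2 *+ 2 - 1) =
  4 * (c ^+ 2 * (z * c) ^+ 2) - 4 * z ^+ 2 * (1 - c ^+ 2) ^+ 2 by ring.
have h2 : 0 <= z ^+ 2 * (1 - c ^+ 2) ^+ 2 by rewrite mulr_ge0 ?sqr_ge0.
by lra.
Qed.

Lemma cos_ge_parabola y : 0 <= y <= pi / 2 -> 1 - y ^+ 2 / 2 <= cos y.
Proof.
move=> /andP[y0 y1]; set z := y / 2.
have -> : y = z *+ 2 by rewrite /z mulr2n; lra.
have z0 : 0 <= z by rewrite /z; lra.
have zp : 0 <= z <= pi / 2 by rewrite /z; lra.
have /andP[_ sz] := sin_mean_value _ zp.
have s0 : 0 <= sin z by apply: sin_ge0_pi; lra.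
by rewrite cos_mulr2n cos2sin2; nra.
Qed.

(** The lower bound is [cos y ^+ 2 / sin y ^+ 4], so this is
    [sqr_mul_cos_le_sin2] squared on one side and [sin y <= y] on the
    other. *)
Lemma invr_pow4_csc y : 0 < y < pi / 2 ->
  sin y ^- 4 - sin y ^- 2 <= y ^- 4 <= sin y ^- 4.
Proof.
move=> /andP[y0 y1]; have yp : 0 <= y <= pi / 2 by lra.
have s0 : 0 < sin y by apply: sin_gt0_pihalf; lra.
have c0 : 0 < cos y by apply: cos_gt0_acute; lra.
have /andP[_ sy] := sin_mean_value _ yp.
apply/andP; split; last first.
  by rewrite lef_pV2 ?posrE ?exprn_gt0// lerXn2r// nnegrE ltW.
have -> : sin y ^- 4 - sin y ^- 2 = cos y ^+ 2 / sin y ^+ 4.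
  by rewrite cos2sin2; field; exact: lt0r_neq0.
rewrite ler_pdivrMr ?exprn_gt0// mulrC ler_pdivlMr ?exprn_gt0//.
have -> : cos y ^+ 2 * y ^+ 4 = (y ^+ 2 * cos y) ^+ 2 by ring.
rewrite (_ : sin y ^+ 4 = (sin y ^+ 2) ^+ 2); last by ring.
rewrite lerXn2r ?nnegrE ?sqr_ge0//; first by rewrite mulr_ge0 ?sqr_ge0 ?ltW.
exact: sqr_mul_cos_le_sin2.
Qed.

End Trigonometry.

(** * The value of zeta(4) *)

Section ZetaFour.
Context {R : realType}.

(** The nodes cut the quarter circle into N equal arcs; with f the square or
    the fourth power of the cosecant the sum is a polynomial in N, and with f
    a power of the inverse it is a partial zeta sum. *)
Definition quarter_sum (f : R -> R) (N : nat) : R :=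
  \sum_(1 <= k < N) f (k%:R * (pi / 2) / N%:R).

Lemma sum_reflect (F : nat -> R) N : (0 < N)%N ->
  \sum_(1 <= k < N.*2) F k =
  \sum_(1 <= k < N) (F k + F (N.*2 - k)%N) + F N.
Proof.
move=> N0; rewrite (@big_cat_nat _ _ _ N) //=; last by lia.
rewrite (@big_ltn _ _ _ N) ?big_split/=; last by lia.
rewrite -addrA [F N + _]addrC; congr (_ + (_ + _)).
rewrite -[N.+1]add1n big_addn -addnn addnK [LHS]big_nat_rev/= addnn.
by apply: eq_big_nat => k /andP[k1 kN]; congr F; lia.
Qed.

(** Pairing k with 2N - k reflects the angle in pi / 4 and turns the nodes of
    step pi / 4N into those of step pi / 2N; the middle node k = N is left
    over. *)
Lemma quarter_sum_double (f g : R -> R) N : (0 < N)%N ->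
  (forall y, 0 < y < pi / 2 -> f y + f (pi / 2 - y) = g (y *+ 2)) ->
  quarter_sum f N.*2 = quarter_sum g N + f (pi / 4).
Proof.
move=> N0 fg; rewrite /quarter_sum sum_reflect//.
have NR : 0 < N%:R :> R by rewrite ltr0n.
have p0 := pi_gt0 R.
have N2 : N.*2%:R = 2 * N%:R :> R by rewrite -muln2 natrM mulrC.
congr (_ + _); last by congr f; rewrite N2; field; lra.
apply: eq_big_nat => k /andP[k1 kN].
set y := k%:R * (pi / 2) / N.*2%:R.
have -> : (N.*2 - k)%:R * (pi / 2) / N.*2%:R = pi / 2 - y.
  by rewrite natrB ?/y ?N2; [field; lra|lia].
have -> : k%:R * (pi / 2) / N%:R = y *+ 2.
  by rewrite /y N2 mulr2n; field; lra.
have k0 : 0 < k%:R :> R by rewrite ltr0n.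
apply: fg; apply/andP; split; first by rewrite /y N2; apply: divr_gt0; nra.
have kN' : k%:R < N%:R :> R by rewrite ltr_nat.
by rewrite /y N2 ltr_pdivrMr; nra.
Qed.

Lemma csc2_reflect y : 0 < y < pi / 2 ->
  sin y ^- 2 + sin (pi / 2 - y) ^- 2 = 4 * sin (y *+ 2) ^- 2 :> R.
Proof.
move=> yp; have s0 := sin_gt0_pihalf yp.
have c0 : 0 < cos y by apply: cos_gt0_acute; lra.
rewrite sinB sin_pihalf cos_pihalf mul1r mul0r subr0 sin_mulr2n.
have s2 := sin2cos2 y.
have -> : sin y ^- 2 + cos y ^- 2 =
  (cos y ^+ 2 + sin y ^+ 2) / (cos y * sin y) ^+ 2.
  by field; rewrite !lt0r_neq0.
by rewrite cos2Dsin2; field; rewrite !lt0r_neq0.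
Qed.

Lemma csc4_reflect y : 0 < y < pi / 2 ->
  sin y ^- 4 + sin (pi / 2 - y) ^- 4 =
  16 * sin (y *+ 2) ^- 4 - 8 * sin (y *+ 2) ^- 2 :> R.
Proof.
move=> yp; have s0 := sin_gt0_pihalf yp.
have c0 : 0 < cos y by apply: cos_gt0_acute; lra.
rewrite sinB sin_pihalf cos_pihalf mul1r mul0r subr0 sin_mulr2n.
have -> : sin y ^- 4 + cos y ^- 4 =
  ((cos y ^+ 2 + sin y ^+ 2) ^+ 2 - 2 * (cos y * sin y) ^+ 2)
    / (cos y * sin y) ^+ 4.
  by field; rewrite !lt0r_neq0.
by rewrite cos2Dsin2; field; rewrite !lt0r_neq0.
Qed.

Lemma sin2_pi4 : sin (pi / 4) ^+ 2 = 1 / 2 :> R.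
Proof.
have := cos_mulr2n (pi / 4 : R); rewrite (_ : pi / 4 *+ 2 = pi / 2); last first.
  by rewrite mulr2n; field.
by rewrite cos_pihalf cos2sin2 => ?; lra.
Qed.

Lemma quarter_sum_lin (f g : R -> R) a b N :
  quarter_sum (fun y => a * f y + b * g y) N =
  a * quarter_sum f N + b * quarter_sum g N.
Proof. by rewrite /quarter_sum big_split/= !big_distrr. Qed.

(** Solves the recurrence B(2N) = 4 B(N) + 2, B(1) = 0, along powers of 2. *)
Lemma quarter_sum_csc2 j (N := (2 ^ j)%N) :
  quarter_sum (fun y => sin y ^- 2) N = 2 / 3 * (N%:R ^+ 2 - 1).
Proof.
rewrite {}/N; elim: j => [|j IH]; first by rewrite /quarter_sum big_geq//; ring.
have N0 : (0 < 2 ^ j)%N by rewrite expn_gt0.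
rewrite expnS mul2n (quarter_sum_double _ (fun y => 4 * sin y ^- 2 + 0 * 0))//.
  rewrite (quarter_sum_lin _ (fun=> 0)) IH sin2_pi4 -muln2 natrM; by field.
by move=> y yp; rewrite csc2_reflect//; ring.
Qed.

(** Solves the recurrence B4(2N) = 16 B4(N) - 8 B2(N) + 4 along powers of 2,
    where B2 is the sum of [quarter_sum_csc2]. *)
Lemma quarter_sum_csc4 j (N := (2 ^ j)%N) :
  quarter_sum (fun y => sin y ^- 4) N =
  (8 * N%:R ^+ 4 + 20 * N%:R ^+ 2 - 28) / 45.
Proof.
rewrite {}/N; elim: j => [|j IH].
  by rewrite /quarter_sum big_geq// expn0; field.
have N0 : (0 < 2 ^ j)%N by rewrite expn_gt0.
rewrite expnS mul2n
  (quarter_sum_double _ (fun y => 16 * sin y ^- 4 + (-8) * sin y ^- 2))//.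
  rewrite quarter_sum_lin IH quarter_sum_csc2.
  rewrite (_ : sin (pi / 4) ^- 4 = 4); last first.
    by rewrite (exprM _ 2 2) sin2_pi4; field.
  by rewrite -muln2 natrM; field.
by move=> y yp; rewrite csc4_reflect//; ring.
Qed.

Definition zeta4_sum (n : nat) : R := \sum_(1 <= k < n) k%:R ^- 4.

(** Summing [invr_pow4_csc] over the nodes encloses the partial sum between
    two explicit polynomials, both with leading term 8 N^4 / 45; the scale
    factor (2N / pi)^4 turns it into pi^4 / 90. *)
Lemma zeta4_sum_dyadic j (N := (2 ^ j)%N) :
  pi ^+ 4 / 90 - pi ^+ 4 / 72 / N%:R ^+ 2 <= zeta4_sum N
  <= pi ^+ 4 / 90 + pi ^+ 4 / 36 / N%:R ^+ 2.
Proof.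
have N0 : (0 < N)%N by rewrite expn_gt0.
have NR : 0 < N%:R :> R by rewrite ltr0n.
have N1 : 1 <= N%:R :> R by rewrite ler1n.
have p0 := pi_gt0 R.
have bnd k : (1 <= k < N)%N -> 0 < (k%:R : R) * (pi / 2) / N%:R < pi / 2.
  move=> /andP[k1 kN]; have k0 : 0 < k%:R :> R by rewrite ltr0n.
  have kR : k%:R < N%:R :> R by rewrite ltr_nat.
  apply/andP; split; first by rewrite divr_gt0// mulr_gt0// divr_gt0.
  by rewrite ltr_pdivrMr//; nra.
have zE : quarter_sum (fun y => y ^- 4) N =
    (2 * N%:R / pi) ^+ 4 * zeta4_sum N.
  rewrite /quarter_sum /zeta4_sum big_distrr/=.
  apply: eq_big_nat => k /andP[k1 _].
  have k0 : k%:R != 0 :> R by rewrite pnatr_eq0; lia.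
  (* the identity holds for every positive number in place of pi *)
  move: (pi : R) p0 => p p0.
  by field; rewrite k0 (lt0r_neq0 NR) (lt0r_neq0 p0).
have up :
    quarter_sum (fun y => y ^- 4) N <= quarter_sum (fun y => sin y ^- 4) N.
  by apply: ler_sum_nat => k /bnd /invr_pow4_csc/andP[].
have lo : 1 * quarter_sum (fun y => sin y ^- 4) N
    + (-1) * quarter_sum (fun y => sin y ^- 2) N
    <= quarter_sum (fun y => y ^- 4) N.
  rewrite -quarter_sum_lin.
  apply: ler_sum_nat => k /bnd /invr_pow4_csc/andP[h _].
  by rewrite mul1r mulN1r.
rewrite zE quarter_sum_csc4 in up.
rewrite zE quarter_sum_csc4 quarter_sum_csc2 in lo.
set c := (2 * N%:R / pi : R) in up lo.
have c0 : 0 < c by rewrite divr_gt0// mulr_gt0.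
have piE : pi = 2 * N%:R / c :> R.
  by rewrite /c; move: (pi : R) p0 => p ?; field; rewrite !lt0r_neq0.
move: c up lo c0 piE {bnd zE} => c up lo c0 piE.
have c40 : 0 < c ^+ 4 by rewrite exprn_gt0.
rewrite piE; apply/andP; split; rewrite -(ler_pM2l c40).
  apply: le_trans lo; rewrite -subr_ge0.
  rewrite [leRHS](_ : _ = 2 / 45) ?divr_ge0//.
  by field; rewrite !lt0r_neq0.
apply: le_trans up _; rewrite -subr_ge0.
rewrite [leRHS](_ : _ = 28 / 45) ?divr_ge0//.
by field; rewrite !lt0r_neq0.
Qed.

Lemma zeta4_sum_nondecreasing : {homo zeta4_sum : m n / (m <= n)%N >-> m <= n}.
Proof.
apply: homo_leq => [//|x y z|n]; first exact: le_trans.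
case: n => [|n]; first by rewrite /zeta4_sum !big_geq.
by rewrite /zeta4_sum [leRHS]big_nat_recr//= lerDl invr_ge0 exprn_ge0.
Qed.

Lemma exists_dyadic_small (C e : R) n : 0 < e ->
  exists2 j, (n <= 2 ^ j)%N & C / (2 ^ j)%N%:R ^+ 2 <= e.
Proof.
move=> e0; pose j := maxn n (Num.bound `|C / e|).
have jlt : (j < 2 ^ j)%N by apply: ltn_expl.
exists j; first by rewrite (leq_trans _ (ltnW jlt))// leq_maxl.
have J1 : 1 <= (2 ^ j)%N%:R :> R by rewrite ler1n expn_gt0.
have Cb : C / e < (2 ^ j)%N%:R.
  apply: le_lt_trans (ler_norm _) _.
  apply: lt_le_trans (archi_boundP (normr_ge0 _)) _.
  by rewrite ler_nat (leq_trans _ (ltnW jlt))// leq_maxr.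
move: Cb; rewrite ltr_pdivrMr// => /ltW Cb.
rewrite ler_pdivrMr ?exprn_gt0 ?(lt_le_trans _ J1)// (le_trans Cb)//.
by rewrite mulrC ler_pM2l// expr2 ler_peMr ?(le_trans _ J1).
Qed.


(** The partial sums increase, so a bound along powers of 2 with vanishing
    error is a bound for all of them. *)
Lemma zeta4_sum_le n : zeta4_sum n <= pi ^+ 4 / 90.
Proof.
apply/ler_addgt0Pr => e e0.
have [j nj /le_trans h] := exists_dyadic_small (pi ^+ 4 / 36) e n e0.
have /andP[_ zj] := zeta4_sum_dyadic j.
rewrite (le_trans (zeta4_sum_nondecreasing _ _ nj))//.
by rewrite (le_trans zj)// lerD2l; exact: h.
Qed.

Lemma zeta4_sum_ge e : 0 < e -> exists n, pi ^+ 4 / 90 - e <= zeta4_sum n.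
Proof.
move=> e0; have [j _ h] := exists_dyadic_small (pi ^+ 4 / 72) e 0 e0.
have /andP[zj _] := zeta4_sum_dyadic j.
by exists (2 ^ j)%N; rewrite (le_trans _ zj)// lerD2l lerN2.
Qed.

End ZetaFour.

(** * Vectors, lines and reflections in the plane *)

Section PlaneVectors.
Context {R : realType}.
Implicit Types (p v w d : R * R) (a b r psi phi gamma : R) (s : side).

(** Direction of the line whose normal is [ndir phi]. As angles are measured
    from the vertical, it points towards increasing angles, that is,
    clockwise. *)
Definition tdir phi : R * R := (cos phi, - sin phi).

Definition ndir phi : R * R := (sin phi, cos phi).

Lemma edotC p v : edot p v = edot v p.
Proof. by rewrite /edot; ring. Qed.

Lemma edotDl p v w : edot (p + v) w = edot p w + edot v w.
Proof. by rewrite /edot/=; ring. Qed.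

Lemma edotZl a p v : edot (a *: p) v = a * edot p v.
Proof. by rewrite /edot/= /GRing.scale/=; ring. Qed.

Lemma edotZr a p v : edot p (a *: v) = a * edot p v.
Proof. by rewrite /edot/= /GRing.scale/=; ring. Qed.

Lemma edot_tdir phi : edot (tdir phi) (tdir phi) = 1.
Proof. by rewrite /edot/= mulrNN -!expr2 cos2Dsin2. Qed.

Lemma edot_tdir_ndir phi : edot (tdir phi) (ndir phi) = 0.
Proof. by rewrite /edot/=; ring. Qed.

Lemma edot_polar_ndir r psi phi :
  edot (polar r psi) (ndir phi) = r * cos (psi - phi).
Proof. by rewrite cosB /edot/=; ring. Qed.

Lemma edot_polar_tdir r psi phi :
  edot (polar r psi) (tdir phi) = r * sin (psi - phi).
Proof. by rewrite sinB /edot/=; ring. Qed.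

Lemma enormZ a p : enorm (a *: p) = `|a| * enorm p.
Proof.
by rewrite /enorm edotZl edotZr mulrA -expr2 sqrtrM ?sqr_ge0// sqrtr_sqr.
Qed.

Lemma enorm_tdir phi : enorm (tdir phi) = 1.
Proof. by rewrite /enorm edot_tdir sqrtr1. Qed.

Lemma enorm_polar r psi : 0 <= r -> enorm (polar r psi) = r.
Proof.
move=> r0; rewrite /enorm /edot/=.
rewrite (_ : _ + _ = r ^+ 2 * (cos psi ^+ 2 + sin psi ^+ 2)); last by ring.
by rewrite cos2Dsin2 mulr1 sqrtr_sqr ger0_norm.
Qed.

Lemma enorm_gt0 p : p != 0 -> 0 < enorm p.
Proof.
move=> p0; rewrite sqrtr_gt0 /edot -!expr2 lt_neqAle addr_ge0 ?sqr_ge0//.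
rewrite andbT eq_sym paddr_eq0 ?sqr_ge0// !sqrf_eq0; apply: contra p0.
by case: p => x y /= /andP[/eqP-> /eqP->].
Qed.

Lemma sqr_enorm p : enorm p ^+ 2 = edot p p.
Proof. by rewrite sqr_sqrtr// /edot -!expr2 addr_ge0 ?sqr_ge0. Qed.

Lemma enorm_edir p v : p != v -> v - p = enorm (v - p) *: edir p v.
Proof.
move=> pv; have : 0 < enorm (v - p) by rewrite enorm_gt0// subr_eq0 eq_sym.
by move=> e0; rewrite /edir scalerA mulfV ?scale1r ?lt0r_neq0.
Qed.

Lemma edot_edir p v : p != v -> edot (edir p v) (edir p v) = 1.
Proof.
move=> pv; have e0 : 0 < enorm (v - p) by rewrite enorm_gt0// subr_eq0 eq_sym.
by rewrite edotZl edotZr -sqr_enorm; field; exact: lt0r_neq0.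
Qed.

Lemma reflect_dirZ gamma s a v :
  reflect_dir gamma s (a *: v) = a *: reflect_dir gamma s v.
Proof.
by rewrite /reflect_dir edotZl scalerBr scalerA mulrCA.
Qed.

(** A reflection in the ray of angle x sends the normal angle phi to 2x - phi
    and reverses the sense in which the vertex is passed. *)
Lemma reflect_tdir gamma s phi :
  reflect_dir gamma s (tdir phi) = - tdir (2 * side_angle gamma s - phi).
Proof.
rewrite /reflect_dir /normal; set x := side_angle gamma s.
rewrite (_ : edot _ _ = cos (phi - x)); last by rewrite cosB /edot/=; ring.
rewrite /tdir (mulr_natl x 2) sinB !cosB sin_mulr2n cos_mulr2n.
have := cos2Dsin2 x.
move: (sin x) (cos x) (sin phi) (cos phi) => sx cx sp cp /(canRL (addKr _)) h.
apply/pair_equal_spec; split; rewrite /= /GRing.scale/=; first by ring.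
apply/eqP; rewrite -subr_eq0; apply/eqP.
transitivity (2 * sp * (sx ^+ 2 - (- cx ^+ 2 + 1))); first by ring.
by rewrite h subrr mulr0.
Qed.

(** The line at distance h from the vertex whose foot lies at angle phi,
    parametrised by the angle a seen from the foot. The tangent of a is an
    affine coordinate on that line, which makes segments easy to follow. *)
Lemma polar_on_line h phi a : cos a != 0 ->
  polar (h / cos a) (phi + a) = h *: (ndir phi + tan a *: tdir phi).
Proof.
move=> a0; rewrite /polar sinD cosD /tan.
by apply/pair_equal_spec; split; rewrite /= /GRing.scale/=; field.
Qed.

End PlaneVectors.

Section Chord.
Context {R : realType}.
Implicit Types (p v : R * R) (gamma h phi a : R).

Lemma edir_tdir p phi c e : 0 < c -> e ^+ 2 = 1 ->
  edir p (p + (c * e) *: tdir phi) = e *: tdir phi.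
Proof.
move=> c0 e1; have ne : `|e| = 1.
  by apply/eqP; rewrite -(eqrXn2 (_ : (0 < 2)%N))// real_normK ?num_real// e1 expr1n.
rewrite /edir addrAC subrr add0r enormZ enorm_tdir mulr1 normrM gtr0_norm// ne.
by rewrite mulr1 scalerA mulrA mulVf ?mul1r// lt0r_neq0.
Qed.

Lemma tan_lt_acute a a' : - (pi / 2) < a -> a < a' -> a' < pi / 2 ->
  tan a < tan a'.
Proof.
move=> a0 aa a1.
by rewrite ltr_tan// in_itv/= ?a0 ?a1 ?(lt_trans a0)// (lt_trans aa).
Qed.

Lemma acute_cos_neq0 a : - (pi / 2) < a -> a < pi / 2 -> cos a != 0.
Proof. by move=> a0 a1; rewrite lt0r_neq0// cos_gt0_pihalf// a0. Qed.

(** The sign e records the sense of travel, so that a increases along every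
    segment. A convex combination of the end points has for tan a the same
    convex combination of tangents; hence its angle stays strictly between
    those of the ends, and the segment is inside the wedge. *)
Lemma chord_in_open_wedge gamma h phi e a a' (p := polar (h / cos a) (phi + e * a))
    (p' := polar (h / cos a') (phi + e * a')) :
  0 < h -> e ^+ 2 = 1 -> - (pi / 2) < a -> a < a' -> a' < pi / 2 ->
  pi / 2 - gamma <= phi + e * a <= pi / 2 ->
  pi / 2 - gamma <= phi + e * a' <= pi / 2 ->
  [/\ p != p', edir p p' = e *: tdir phi &
    forall t, 0 < t < 1 -> open_wedge gamma ((1 - t) *: p + t *: p')].
Proof.
move=> h0 e2 a0 aa a1 w w'.
have eE : e = 1 \/ e = -1.
  by move/eqP: e2; rewrite sqrf_eq1 => /orP[] /eqP; [left|right].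
have cosE x : cos (e * x) = cos x by case: eE => ->; rewrite ?mul1r ?mulN1r ?cosN.
have tanE x : tan (e * x) = e * tan x.
  by case: eE => ->; rewrite ?mul1r ?mulN1r ?tanN.
have polE x : - (pi / 2) < x -> x < pi / 2 -> polar (h / cos x) (phi + e * x) =
    h *: (ndir phi + (e * tan x) *: tdir phi).
  by move=> x0 x1; rewrite -cosE polar_on_line ?tanE// cosE acute_cos_neq0.
have tt := tan_lt_acute a a' a0 aa a1.
have c0 : 0 < h * (tan a' - tan a) by rewrite mulr_gt0// subr_gt0.
have pE : p = h *: (ndir phi + (e * tan a) *: tdir phi).
  by rewrite /p polE// (lt_trans aa).
have p'E : p' = h *: (ndir phi + (e * tan a') *: tdir phi).
  by rewrite /p' polE// (lt_trans a0).
have pp' : p' = p + (h * (tan a' - tan a) * e) *: tdir phi.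
  rewrite p'E pE; apply/pair_equal_spec; split; rewrite /= /GRing.scale/=; ring.
split.
- apply/eqP => pp; move: pp'; rewrite -pp -{1}[p]addr0 => /addrI/esym/eqP.
  rewrite scaler_eq0 mulf_eq0 (gt_eqF c0)/=.
  case/orP => /eqP h1.
    by move: e2; rewrite h1 expr0n => /eqP; rewrite eq_sym oner_eq0.
  by have := edot_tdir phi; rewrite h1 /edot/= !mul0r addr0 => /eqP;
    rewrite eq_sym oner_eq0.
- by rewrite pp' edir_tdir.
- move=> t /andP[t0 t1]; set x := atan ((1 - t) * tan a + t * tan a').
  have x1 : - (pi / 2) < x := atan_gtNpi2 _.
  have x2 : x < pi / 2 := atan_ltpi2 _.
  have ax : a < x.
    rewrite -(tanK (x := a)) ?in_itv/= ?a0 ?(lt_trans aa)//.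
    by apply: lt_atan; nra.
  have xa : x < a'.
    rewrite -[ltRHS](tanK (x := a')) ?in_itv/= ?a1 ?(lt_trans a0)//.
    by apply: lt_atan; nra.
  exists (h / cos x), (phi + e * x); split.
  + by rewrite divr_gt0// cos_gt0_pihalf// x1.
  + by case: eE w w' => -> ? ?; lra.
  + rewrite polE// pE p'E /x atanK.
    by apply/pair_equal_spec; split; rewrite /= /GRing.scale/=; ring.
Qed.

End Chord.

(** * Unfolding a path that alternates between the two rays *)

Section Unfolding.
Context {R : realType}.
Implicit Types (p v : R * R) (q : nat -> R * R) (gamma beta h r psi : R).

Definition bside (k : nat) : side := if odd k then Inclined else Horizontal.

(** Angle of the foot of the perpendicular from the vertex to the line of
    segment k. Bounce k is at the end of that segment, on the ray [bside k];
    in the unfolded picture it is seen from the foot under the angle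
    beta + k gamma, and the sign undoes the unfolding. *)
Definition foot gamma beta (k : nat) : R :=
  side_angle gamma (bside k) - (-1) ^+ k * (beta + k%:R * gamma).

Lemma side_angleS gamma k : side_angle gamma (bside k.+1) =
  side_angle gamma (bside k) - (-1) ^+ k * gamma.
Proof.
by rewrite -signr_odd /bside/=; case: (odd k); rewrite /= ?expr1 ?expr0; ring.
Qed.

(** This is the action of a reflection on normal angles in [reflect_tdir]: the
    formula of [foot] is consistent from one segment to the next. *)
Lemma footS gamma beta k :
  foot gamma beta k.+1 = 2 * side_angle gamma (bside k) - foot gamma beta k.
Proof. by rewrite /foot side_angleS exprS -natr1; ring. Qed.

(** [foot_end] and [foot_start] say that a reflection point is seen under the
    same unfolded angle from the segment it ends and from the one it
    starts. *)
Lemma foot_end gamma beta k :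
  foot gamma beta k + (-1) ^+ k * (beta + k%:R * gamma) =
  side_angle gamma (bside k).
Proof. by rewrite /foot; ring. Qed.

Lemma foot_start gamma beta k :
  foot gamma beta k.+1 + (-1) ^+ k.+1 * (beta + k%:R * gamma) =
  side_angle gamma (bside k).
Proof. by rewrite footS /foot exprS; ring. Qed.

Lemma foot0 gamma beta : foot gamma beta 0 = pi / 2 - beta.
Proof. by rewrite /foot expr0 mul1r mul0r addr0. Qed.

Lemma foot_even gamma beta m :
  foot gamma beta (2 * m) = pi / 2 - beta - (2 * m)%:R * gamma.
Proof. by rewrite /foot /bside -signr_odd oddM/= expr0; ring. Qed.

Lemma reflect_foot gamma beta k :
  reflect_dir gamma (bside k) ((-1) ^+ k *: tdir (foot gamma beta k)) =
  (-1) ^+ k.+1 *: tdir (foot gamma beta k.+1).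
Proof.
by rewrite reflect_dirZ reflect_tdir -footS exprS mulN1r scaleNr scalerN.
Qed.

Lemma side_angle_bounds gamma s : 0 <= gamma ->
  pi / 2 - gamma <= side_angle gamma s <= pi / 2.
Proof. by case: s => /= g0; rewrite ?lexx ?andbT; lra. Qed.

End Unfolding.

(** * Existence of the closed path *)

Section ExistencePath.
Context {R : realType}.
Variables (gamma : R) (m : nat) (r psi : R).
Hypothesis gamma_gt0 : 0 < gamma.
Hypothesis gamma_lt : gamma < pi / 2.
Hypothesis mgamma_lt : m%:R * gamma < pi / 2.
Hypothesis m_gt0 : (0 < m)%N.
Hypothesis r_gt0 : 0 < r.
Hypothesis psi_gt : pi / 2 - gamma < psi.
Hypothesis psi_lt : psi < pi / 2.

(* this beta puts the two ends of the unfolded path, which lie on the same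
   circle, at the symmetric angles - m gamma and m gamma from the foot *)
Let beta := pi / 2 - psi - m%:R * gamma.

Definition unfolded_angle (k : nat) : R :=
  if k is k'.+1 then
    if (k' < 2 * m)%N then beta + k'%:R * gamma else m%:R * gamma
  else - (m%:R * gamma).

Definition real_angle (k : nat) : R :=
  if k is k'.+1 then
    if (k' < 2 * m)%N then side_angle gamma (bside k') else psi
  else psi.

Definition billiard_path (k : nat) : R * R :=
  polar (r * cos (m%:R * gamma) / cos (unfolded_angle k)) (real_angle k).

Let mg0 : 0 < m%:R * gamma.
Proof. by rewrite mulr_gt0// ltr0n. Qed.

Lemma unfolded_angle_mono k : (k <= 2 * m)%N ->
  unfolded_angle k < unfolded_angle k.+1.
Proof.
case: k => [_|k km] /=.
  by rewrite muln_gt0 m_gt0/= mul0r addr0 /beta; have := psi_lt; lra.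
rewrite km; case: ltnP => [_|mk]; first by rewrite -natr1; have := gamma_gt0; lra.
have -> : k = (2 * m).-1 by lia.
rewrite -subn1 natrB ?natrM; last by lia.
by rewrite /beta; have := psi_gt; lra.
Qed.

Lemma unfolded_angle_bounds k :
  - (m%:R * gamma) <= unfolded_angle k <= m%:R * gamma.
Proof.
case: k => [|k] /=; first by have := mg0; lra.
case: ltnP => [km|_]; last by have := mg0; lra.
have kg : 0 <= k%:R * gamma by rewrite mulr_ge0// ltW.
have kgm : (k.+1)%:R * gamma <= (2 * m)%:R * gamma.
  by rewrite ler_pM2r// ler_nat.
rewrite -natr1 natrM in kgm.
by rewrite /beta; have := psi_gt; have := psi_lt; lra.
Qed.

Lemma real_angleE k : (k <= 2 * m)%N ->
  foot gamma beta k + (-1) ^+ k * unfolded_angle k = real_angle k /\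
  foot gamma beta k + (-1) ^+ k * unfolded_angle k.+1 = real_angle k.+1.
Proof.
move=> km; split.
  case: k km => [|k] km /=; first by rewrite foot0 expr0 /beta; ring.
  by rewrite km foot_start.
rewrite /=; case: ltnP => [|mk]; first by rewrite foot_end.
have -> : k = (2 * m)%N by apply/eqP; rewrite eqn_leq km.
by rewrite foot_even -signr_odd oddM/= expr0 natrM /beta; ring.
Qed.

Lemma real_angle_bounds k : pi / 2 - gamma <= real_angle k <= pi / 2.
Proof.
case: k => [|k]/=; first by rewrite !ltW.
by case: ifP => _; [exact/side_angle_bounds/ltW|rewrite !ltW].
Qed.

(** Unfolded, every point of the path lies on a chord of the circle of radius
    r, at distance r cos (m gamma) from its centre. *)
Lemma enorm_billiard_path k :
  r * cos (m%:R * gamma) <= enorm (billiard_path k) <= r.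
Proof.
have /andP[u1 u2] := unfolded_angle_bounds k.
have c0 : 0 < cos (m%:R * gamma).
  by apply: cos_gt0_pihalf; have := mg0; have := mgamma_lt; lra.
have cu : cos (m%:R * gamma) <= cos (unfolded_angle k).
  have p2 : pi / 2 < pi :> R by have := pi_gt0 R; lra.
  have := mg0; have := mgamma_lt => ? ?.
  have uabs : `|unfolded_angle k| <= m%:R * gamma by rewrite ler_norml u1 u2.
  rewrite -(cos_norm (unfolded_angle k)).
  have [->//|ne] := eqVneq `|unfolded_angle k| (m%:R * gamma).
  have um : `|unfolded_angle k| < m%:R * gamma by rewrite lt_neqAle ne.
  by rewrite ltW// ltr_cos// in_itv/= ?normr_ge0/=; lra.
have cu0 : 0 < cos (unfolded_angle k) := lt_le_trans c0 cu.
rewrite enorm_polar; last by rewrite !mulr_ge0 ?invr_ge0// ltW.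
rewrite ler_pdivlMr// ler_pdivrMr// ler_pM2l//.
by rewrite cu ler_piMr ?cos_le1// mulr_ge0 ?ltW.
Qed.

(** When the whole range of distances of [enorm_billiard_path] is within the
    plate, the plate condition holds without looking at individual bounces. *)
Lemma billiard_path_plate R0 R1 : R0 <= r * cos (m%:R * gamma) -> r <= R1 ->
  plate_path gamma R0 R1 (2 * m) (polar r psi) billiard_path.
Proof.
move=> hR0 hR1.
have c0 : 0 < cos (m%:R * gamma).
  by apply: cos_gt0_pihalf; have := mg0; have := mgamma_lt; lra.
have h0 : 0 < r * cos (m%:R * gamma) by rewrite mulr_gt0.
have chord k : (k <= 2 * m)%N -> [/\ billiard_path k != billiard_path k.+1,
    edir (billiard_path k) (billiard_path k.+1) =
      (-1) ^+ k *: tdir (foot gamma beta k) &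
    forall t, 0 < t < 1 -> open_wedge gamma
      ((1 - t) *: billiard_path k + t *: billiard_path k.+1)].
  move=> km; have [e1 e2] := real_angleE k km.
  rewrite /billiard_path -e2 -e1.
  have /andP[? ?] := unfolded_angle_bounds k.
  have /andP[? ?] := unfolded_angle_bounds k.+1.
  have ? := mgamma_lt.
  apply: chord_in_open_wedge => //; rewrite ?e1 ?e2 ?real_angle_bounds//; try lra.
  - by rewrite -exprM mulnC exprM sqrrN !expr1n.
  - exact: unfolded_angle_mono.
have pE : r * cos (m%:R * gamma) / cos (m%:R * gamma) = r.
  by rewrite mulfK// lt0r_neq0.
have rayE k : (k < 2 * m)%N -> ray gamma (bside k) (billiard_path k.+1).
  move=> km; rewrite /billiard_path/= km.
  exists (r * cos (m%:R * gamma) / cos (beta + k%:R * gamma)) => //.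
  rewrite divr_gt0//; have := unfolded_angle_bounds k.+1; rewrite /= km.
  by move=> /andP[? ?]; apply: cos_gt0_pihalf; have := mgamma_lt; lra.
split.
- split.
  + by exists r, psi; split=> //; rewrite !ltW.
  + by rewrite /billiard_path/= cosN pE.
  + by rewrite /billiard_path/= ltnn pE.
  + by move=> k km; have [? _ ?] := chord k km.
  + move=> k km; exists (bside k); split; first exact: rayE.
    have [_ -> _] := chord k.+1 km; have [_ -> _] := chord k (ltnW km).
    by rewrite reflect_foot.
- by apply: (rayE 0%N); rewrite muln_gt0.
- move=> k _ _; have /andP[a1 a2] := enorm_billiard_path k.+1.
  by rewrite (le_trans hR0)//= (le_trans a2).
Qed.

End ExistencePath.

(** * Uniqueness of the closed path *)

Section NecessaryPath.
Context {R : realType}.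
Implicit Types (p v : R * R) (q : nat -> R * R) (gamma r psi : R) (s : side).

(** The inner product with the normal of a ray vanishes at both points, hence
    at their midpoint, but has no zero in the open wedge. So two consecutive
    reflections are never on the same ray. *)
Lemma open_wedge_ray_disjoint gamma s p v : 0 < gamma < pi / 2 ->
  ray gamma s p -> ray gamma s v ->
  ~ open_wedge gamma ((1 - 2^-1) *: p + 2^-1 *: v).
Proof.
move=> g01 [r1 _ ->] [r2 _ ->] [r3 [psi [r30 psib e]]].
have zE r : edot (polar r (side_angle gamma s)) (normal gamma s) = 0.
  by rewrite /edot/=; ring.
have : edot (polar r3 psi) (normal gamma s) = 0.
  by rewrite -e edotDl !edotZl !zE !mulr0 addr0.
rewrite (_ : edot _ _ = r3 * sin (psi - side_angle gamma s)); last first.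
  by rewrite sinB /edot/=; ring.
move/eqP; rewrite mulf_eq0 (gt_eqF r30)/=; apply/negP.
case: s {zE e} => /=; last by rewrite gt_eqF// sin_gt0_pihalf//; lra.
by rewrite -(opprB (pi / 2)) sinN oppr_eq0 gt_eqF// sin_gt0_pihalf//; lra.
Qed.

Lemma ray_inj gamma s s' p : 0 < gamma < pi / 2 ->
  ray gamma s p -> ray gamma s' p -> s = s'.
Proof.
move=> g01; have sg := sin_gt0_pihalf g01.
have hi r1 r2 : 0 < r2 -> polar r1 (side_angle gamma Horizontal) <>
    polar r2 (side_angle gamma Inclined).
  move=> r20 /(congr1 snd)/esym/eqP; rewrite /= cosB cos_pihalf sin_pihalf.
  rewrite mul0r add0r mul1r mulr0; apply/negP.
  by rewrite mulf_neq0// lt0r_neq0.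
case: s; case: s' => // -[r1 ? ->] [r2 ? e]; first by case: (hi _ _ _ e).
by case: (hi _ _ _ (esym e)).
Qed.

(** Consecutive bounces are on different rays, so the first side determines
    all of them. *)
Lemma closed_path_sides gamma n p q : 0 < gamma < pi / 2 ->
  closed_bounce_path gamma n p q -> ray gamma Horizontal (q 1%N) ->
  forall k, (k < n)%N -> ray gamma (bside k) (q k.+1) /\
    edir (q k.+1) (q k.+2) = reflect_dir gamma (bside k) (edir (q k) (q k.+1)).
Proof.
move=> g01 [_ _ _ seg refl] q1; elim=> [|k IH] kn.
  have [s [rs es]] := refl 0%N kn.
  by rewrite (_ : bside 0 = s)//; exact: ray_inj q1 rs.
have [s [rs es]] := refl k.+1 kn; have [rk _] := IH (ltnW kn).
have [_ /(_ 2^-1)] := seg k.+1 (ltnW kn).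
have half : 0 < (2^-1 : R) < 1 by rewrite invr_gt0 ltr0n invf_lt1 ?ltr1n.
move=> /(_ half) ow.
suff -> : bside k.+1 = s by [].
move: rk ow; rewrite /bside/=; case: (odd k) => /= rk ow; case: s rs es => // rs _.
  by case: (open_wedge_ray_disjoint _ _ _ _ g01 rk rs ow).
by case: (open_wedge_ray_disjoint _ _ _ _ g01 rk rs ow).
Qed.

(** The first segment ends on the horizontal ray, so it passes the vertex
    clockwise. With e the radial unit vector at q 0, d the direction and n the
    normal of the segment, n . e > 0 is the cosine and d . e the sine of an
    angle in the open right half circle, which an arcsine recovers. *)
Lemma first_segment_direction gamma r psi q : 0 < gamma < pi / 2 -> 0 < r ->
  pi / 2 - gamma < psi < pi / 2 -> q 0%N = polar r psi -> q 0%N != q 1%N ->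
  ray gamma Horizontal (q 1%N) ->
  exists2 phi, - (pi / 2) < psi - phi < pi / 2 &
    edir (q 0%N) (q 1%N) = tdir phi.
Proof.
move=> g01 r0 psib q0E q01 [rho rho0 q1E].
have uE := edot_edir _ _ q01; have := enorm_edir _ _ q01.
set t := enorm _; have t0 : 0 < t.
  by apply: enorm_gt0; rewrite subr_eq0 eq_sym.
move: uE; case: (edir _ _) => d1 d2 uE; rewrite q0E q1E /polar/=.
rewrite sin_pihalf cos_pihalf mulr0 mulr1 => dE.
have d1E : rho - r * sin psi = t * d1 by case: dE.
have d2E : - (r * cos psi) = t * d2 by case: dE; rewrite sub0r.
have cpsi : 0 < cos psi by apply: cos_gt0_pihalf; lra.
have cs := cos2Dsin2 psi.
pose c := d1 * cos psi - d2 * sin psi; pose s := d1 * sin psi + d2 * cos psi.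
have c0 : 0 < c.
  rewrite -(pmulr_rgt0 _ t0) (_ : t * c = rho * cos psi) ?mulr_gt0//.
  rewrite /c mulrBr !mulrA -d1E -d2E; ring.
have cs1 : c ^+ 2 + s ^+ 2 = 1.
  transitivity ((d1 * d1 + d2 * d2) * (cos psi ^+ 2 + sin psi ^+ 2)).
    by rewrite /c /s; ring.
  by rewrite cs mulr1 -[RHS]uE.
have s1 : -1 < s < 1.
  by apply/andP; split; nra.
have sl : -1 <= s <= 1 by case/andP: s1 => ? ?; rewrite !ltW.
have cd : cos (asin s) = c.
  rewrite cos_asin// (_ : 1 - s ^+ 2 = c ^+ 2); last by rewrite -cs1; ring.
  by rewrite sqrtr_sqr ger0_norm// ltW.
have sd : sin (asin s) = s by rewrite asinK// in_itv.
exists (psi - asin s).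
  rewrite opprB addrC subrK.
  by rewrite asin_gtNpi2 ?asin_ltpi2//; case/andP: s1 => ? ?; rewrite ?ltW ?andbT.
rewrite /tdir cosB sinB cd sd /c /s; congr pair.
  transitivity (d1 * (cos psi ^+ 2 + sin psi ^+ 2)); last by ring.
  by rewrite cs mulr1.
transitivity (d2 * (cos psi ^+ 2 + sin psi ^+ 2)); last by ring.
by rewrite cs mulr1.
Qed.
End NecessaryPath.

Section NecessaryPathShape.
Context {R : realType}.
Implicit Types (p v : R * R) (q : nat -> R * R) (gamma r psi h x : R).

(** Singles out the branch of the unfolded angle of the next reflection point:
    its cosine is h over the distance of that point to the vertex, hence
    positive. *)
Lemma lt_pihalf_of_cos_gt0 x : x < pi -> 0 < cos x -> x < pi / 2.
Proof.
move=> xpi c0; rewrite ltNge; apply/negP => px; move: c0.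
have -> : x = (x - pi / 2) + pi / 2 by rewrite subrK.
by rewrite cosDpihalf oppr_gt0 ltNge sin_ge0_pi//; lra.
Qed.

Lemma cos_sgn k x : cos ((-1) ^+ k * x) = cos x.
Proof. by rewrite -signr_odd; case: odd; rewrite /= ?mul1r ?mulN1r ?cosN. Qed.

(** Moving along a line does not change its distance h to the vertex. *)
Lemma edot_advance p v c phi : p != v -> edir p v = c *: tdir phi ->
  edot v (ndir phi) = edot p (ndir phi).
Proof.
move=> /enorm_edir vE dE; rewrite -{1}(subrK p v) edotDl vE dE.
by rewrite !edotZl edot_tdir_ndir !mulr0 add0r.
Qed.

(** A reflection fixes its ray, so the abscissa along the line of travel is
    continuous at a bounce; this makes the length of the path telescope. *)
Lemma edot_reflect_ray gamma s p v : ray gamma s p ->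
  edot p (reflect_dir gamma s v) = edot p v.
Proof.
move=> [rho _ ->]; rewrite /reflect_dir addrC edotC edotDl -scaleNr edotZl.
rewrite [edot (normal _ _) _]edotC (_ : edot (polar _ _) (normal _ _) = 0).
  by rewrite mulr0 add0r edotC.
by rewrite /edot/=; ring.
Qed.

(** Induction along the path shows that all segments are at the same distance
    h from the vertex and that the unfolded angle of bounce k is
    beta + k gamma, with beta the unknown. The last point is p again: it is at
    distance r under unfolded angles x - 2 m gamma (start) and x (end), both
    of cosine h / r, hence x = m gamma. This fixes beta, gives
    h = r cos (m gamma) and forces m gamma < pi / 2; the length is that of a
    chord subtending 2 m gamma. *)
Lemma closed_path_shape gamma m r psi q (mg := m%:R * gamma)
    (B := fun k => pi / 2 - psi - mg + k%:R * gamma) :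
  0 < gamma < pi / 2 -> (0 < m)%N -> 0 < r -> pi / 2 - gamma < psi < pi / 2 ->
  closed_bounce_path gamma (2 * m) (polar r psi) q ->
  ray gamma Horizontal (q 1%N) ->
  [/\ mg < pi / 2, path_length (2 * m) q = 2 * r * sin mg &
    forall k, (k < 2 * m)%N -> - (pi / 2) < B k < pi / 2 /\
      q k.+1 = polar (r * cos mg / cos (B k)) (side_angle gamma (bside k))].
Proof.
move=> g01 m0 r0 psib path ray1; have sides := closed_path_sides _ _ _ _ g01 path ray1.
have [_ q0E qnE seg _] := path.
have p0 := pi_gt0 R.
have qne k : (k <= 2 * m)%N -> q k != q k.+1 by move/seg => [].
have [phi phib dir0] := first_segment_direction _ _ _ _ g01 r0 psib q0E (qne 0%N isT) ray1.
pose beta := pi / 2 - phi; pose A k := beta + k%:R * gamma.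
pose h := r * cos (psi - phi).
have h0 : 0 < h by rewrite mulr_gt0// cos_gt0_pihalf.
have phiE : phi = foot gamma beta 0 by rewrite foot0 /beta; ring.
have foot_sub k : foot gamma beta k.+1 - side_angle gamma (bside k) =
    (-1) ^+ k * A k.
  by rewrite -(foot_start gamma beta) exprS /A; ring.
(* the direction of every segment and the position of every reflection *)
have main k : (k < 2 * m)%N ->
    [/\ edir (q k) (q k.+1) = (-1) ^+ k *: tdir (foot gamma beta k),
      - (pi / 2) < A k < pi / 2 &
      q k.+1 = polar (h / cos (A k)) (side_angle gamma (bside k))].
  (* the next reflection point is determined by its ray and by h *)
  have hit j rho : 0 < rho -> - (pi / 2) < A j < pi ->
      q j.+1 = polar rho (side_angle gamma (bside j)) ->
      edot (q j.+1) (ndir (foot gamma beta j)) = h ->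
      - (pi / 2) < A j < pi / 2 /\
      q j.+1 = polar (h / cos (A j)) (side_angle gamma (bside j)).
    move=> rho0 /andP[A0 Api] qE.
    rewrite qE edot_polar_ndir -(foot_end gamma beta j) addrC addKr cos_sgn.
    rewrite -/(A j) => hE.
    have c0 : 0 < cos (A j) by rewrite -(pmulr_rgt0 _ rho0) hE.
    split; last by rewrite -hE mulfK// lt0r_neq0.
    by rewrite A0 lt_pihalf_of_cos_gt0.
  elim: k => [|k IH] km.
    have dir : edir (q 0%N) (q 1%N) = (-1) ^+ 0 *: tdir (foot gamma beta 0).
      by rewrite -phiE expr0 scale1r.
    have [[rho rho0 q1E] _] := sides 0%N km.
    have A0 : A 0%N = beta by rewrite /A mul0r addr0.
    have Ab : - (pi / 2) < A 0%N < pi by rewrite A0 /beta; lra.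
    have hd : edot (q 1%N) (ndir (foot gamma beta 0)) = h.
      rewrite (edot_advance _ _ _ _ (qne 0%N isT) dir) q0E -phiE.
      exact: edot_polar_ndir.
    by have [] := hit 0%N rho rho0 Ab q1E hd.
  have [dk Ak qk] := IH (ltnW km).
  have [[rho rho0 qSE] _] := sides k.+1 km.
  have [_ refl] := sides k (ltnW km).
  rewrite dk reflect_foot in refl.
  have AS : A k.+1 = A k + gamma by rewrite /A -natr1; ring.
  have Ab : - (pi / 2) < A k.+1 < pi by rewrite AS; lra.
  have hd : edot (q k.+2) (ndir (foot gamma beta k.+1)) = h.
    rewrite (edot_advance _ _ _ _ (qne k.+1 (ltnW km)) refl) qk edot_polar_ndir.
    by rewrite -opprB foot_sub cosN cos_sgn divfK// lt0r_neq0// cos_gt0_pihalf.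
  by have [] := hit k.+1 rho rho0 Ab qSE hd.
have mgE : (2 * m)%:R * gamma = mg *+ 2.
  by rewrite /mg natrM mulr2n; ring.
have mgp : 0 < mg by rewrite mulr_gt0 ?ltr0n//; case/andP: g01.
pose k0 := (2 * m).-1; have k0m : (k0 < 2 * m)%N.
  by rewrite ltn_predL muln_gt0.
have k0S : k0.+1 = (2 * m)%N by rewrite prednK// muln_gt0.
have [dk0 Ak0 qk0] := main k0 k0m.
have [_ dirn] := sides k0 k0m; rewrite dk0 reflect_foot k0S in dirn.
have AS : A k0 + gamma = beta + mg *+ 2 by rewrite -mgE -k0S -natr1 /A; ring.
pose x := psi - foot gamma beta (2 * m).
have xE : x = psi - phi + mg *+ 2 by rewrite /x foot_even mgE /beta; ring.
have hx : r * cos x = h.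
  have qne' : q (2 * m)%N != q (2 * m).+1 := qne _ (leqnn _).
  have adv := edot_advance _ _ _ _ qne' dirn.
  rewrite qnE edot_polar_ndir in adv.
  rewrite /x adv -k0S qk0 edot_polar_ndir.
  by rewrite -opprB foot_sub cosN cos_sgn divfK// lt0r_neq0// cos_gt0_pihalf.
have xb : - (pi / 2) < x < pi / 2.
  have xA : x = A k0 + gamma + (psi - pi / 2) by rewrite AS xE /beta; ring.
  have c0 : 0 < cos x by rewrite -(pmulr_rgt0 _ r0) hx.
  have xpi : x < pi by rewrite xA; lra.
  by rewrite lt_pihalf_of_cos_gt0// andbT xA; lra.
(* both ends of the unfolded path lie on the circle of radius r, so they are
   symmetric with respect to the foot *)
have xN : psi - phi = - mg.
  have cx : cos x = cos (psi - phi).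
    by apply: (mulfI (lt0r_neq0 r0)); rewrite hx.
  have : `|x| = `|psi - phi|.
    apply: (@cos_inj R); rewrite ?in_itv/= ?normr_ge0/= ?cos_norm//.
    - by rewrite ler_norml; lra.
    - by rewrite ler_norml; lra.
  move/eqP; rewrite eqr_norm2 => /orP[] /eqP; rewrite xE mulr2n; lra.
have hE : h = r * cos mg by rewrite /h xN cosN.
have BE k : B k = A k by rewrite /B /A /beta -xN; ring.
split.
- by move: xb; rewrite xE xN mulr2n; lra.
- pose d k := (-1) ^+ k *: tdir (foot gamma beta k).
  have dirE k : (k <= 2 * m)%N -> edir (q k) (q k.+1) = d k.
    rewrite leq_eqVlt => /predU1P[->//|/main[]//].
  have lenE k : (k <= 2 * m)%N ->
      enorm (q k.+1 - q k) = edot (q k.+1) (d k) - edot (q k) (d k).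
    move=> km; have qk := qne k km; have e1 := enorm_edir _ _ qk.
    have e2 := edot_edir _ _ qk; rewrite -(dirE k km).
    rewrite -{2}(subrK (q k) (q k.+1)) edotDl addrK.
    by rewrite {2}e1 edotZl e2 mulr1.
  rewrite /path_length big_ord_recr/= lenE//.
  rewrite (eq_bigr (fun k : 'I_(2 * m) =>
      edot (q k.+1) (d k.+1) - edot (q k) (d k))); last first.
    move=> k _; have km := ltn_ord k; rewrite lenE ?(ltnW km)//.
    have [rk _] := sides k km.
    by rewrite -(edot_reflect_ray _ _ _ (d k) rk) reflect_foot.
  rewrite -(big_mkord xpredT (fun k => edot (q k.+1) (d k.+1) - edot (q k) (d k))).
  rewrite telescope_sumr// qnE q0E /d !edotZr !edot_polar_tdir -/x -phiE xN.
  rewrite expr0 -signr_odd oddM/= expr0 sinN.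
  have -> : x = mg by rewrite xE xN mulr2n; ring.
  by ring.
- by move=> k km; have [_ ? ?] := main k km; rewrite BE -hE.
Qed.
End NecessaryPathShape.

(** * Bounding integrals over sets not known to be measurable *)

Section MonotoneIntegral.
Context d (T : measurableType d) (R : realType).
Variable mu : {measure set T -> \bar R}.
Implicit Types (D E : set T) (f : T -> R) (M : R).

(** The integral of a nonnegative function is a supremum over simple functions
    below it, so monotonicity needs no measurability. This lets the domain of
    2m-bounce paths be compared with rectangles without describing it
    exactly. *)
Lemma le_integral_patch D E (f g : T -> \bar R) :
  (forall x, D x -> 0 <= f x)%E -> (forall x, E x -> 0 <= g x)%E ->
  (forall x, D x -> f x <= (g \_ E) x)%E ->
  (\int[mu]_(x in D) f x <= \int[mu]_(x in E) g x)%E.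
Proof.
move=> f0 g0 fg; rewrite !ge0_integralE//.
apply: ereal_sup_le => _ [h /= hf <-]; exists h => //= x.
apply: (le_trans (hf x)); rewrite {1}/patch; case: ifPn => [|_].
  by rewrite inE; exact: fg.
by rewrite /patch; case: ifPn => //; rewrite inE => /g0.
Qed.

Lemma integral_le_cst D E f M : measurable E -> 0 <= M -> D `<=` E ->
  (forall x, D x -> 0 <= f x <= M) ->
  (\int[mu]_(x in D) (f x)%:E <= M%:E * mu E)%E.
Proof.
move=> mE M0 DE fM; rewrite -(integral_cst _ mE) le_integral_patch//.
- by move=> x /fM /andP[]; rewrite lee_fin.
- by move=> x Dx; rewrite patchT ?inE; [case/andP: (fM x Dx); rewrite lee_fin|exact: DE].
Qed.

Lemma cst_le_integral D E f M : measurable E -> 0 <= M -> E `<=` D ->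
  (forall x, D x -> 0 <= f x) -> (forall x, E x -> M <= f x) ->
  (M%:E * mu E <= \int[mu]_(x in D) (f x)%:E)%E.
Proof.
move=> mE M0 ED f0 fM; rewrite -(integral_cst _ mE) le_integral_patch//.
by move=> x Ex; rewrite patchT ?inE ?lee_fin; [exact: fM|exact: ED].
Qed.

End MonotoneIntegral.

(** * The integral over the domain of 2m-bounce paths *)

Section DomainIntegral.
Context {R : realType}.
Implicit Types (gamma : R) (z : R * R).

Definition polar_box gamma (a b : R) : set (R * R) :=
  `[a, b]%classic `*` `]pi / 2 - gamma, pi / 2[%classic.

Lemma measurable_polar_box gamma a b :
  measurable (polar_box gamma a b : set (measurableTypeR R * measurableTypeR R)).
Proof. by apply: measurableX; exact: measurable_itv. Qed.

Lemma measure_polar_box gamma a b : 0 < gamma -> a <= b ->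
  (@lebesgue_measure R \x @lebesgue_measure R)%E (polar_box gamma a b) =
  ((b - a) * gamma)%:E.
Proof.
move=> g0 ab; rewrite /polar_box product_measure1E; [|exact: measurable_itv..].
transitivity (lebesgue_measure `[a, b]%classic *
    lebesgue_measure `](pi / 2 - gamma)%R, (pi / 2)%R[%classic)%E; first by [].
rewrite !lebesgue_measure_itv/= !lte_fin ltrBlDr ltrDl g0 -!EFinD.
case: ltP => [_|ba]; last first.
  by rewrite (_ : b = a) ?subrr ?mul0r ?mul0e//; apply/eqP; rewrite eq_le ba.
by rewrite -EFinM; congr (_ * _)%:E; ring.
Qed.

(** The inclined bounce closest to the foot is seen under an angle at most
    gamma, so its distance to the vertex, r cos (m gamma) over the cosine of
    that angle, is within a factor cos gamma of r cos (m gamma). The plate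
    condition at this single bounce already gives both bounds. *)
Lemma plate_path_bounds gamma (R0 R1 : R) m r psi q (mg := m%:R * gamma) :
  0 < gamma < pi / 2 -> (0 < m)%N -> 0 <= R0 ->
  0 < r -> pi / 2 - gamma < psi < pi / 2 ->
  plate_path gamma R0 R1 (2 * m) (polar r psi) q ->
  [/\ mg < pi / 2, path_length (2 * m) q = 2 * r * sin mg &
    R0 * cos gamma <= r * cos mg <= R1].
Proof.
move=> g01 m0 R00 r0 psib [path ray1 plate].
have [mgb lenE shape] := closed_path_shape _ _ _ _ _ g01 m0 r0 psib path ray1.
split=> //; rewrite -/mg in mgb shape.
(* the reflection off the inclined ray next to the foot *)
pose k := if odd m then m else m.-1.
have kodd : odd k by rewrite /k; case: ifPn => //; lia.
have km : (k < 2 * m)%N by rewrite /k; case: ifPn; lia.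
have [Bb qE] := shape k km.
set B := pi / 2 - psi - mg + k%:R * gamma in Bb qE.
have Bg : `|B| <= gamma.
  rewrite ler_norml /B /k /mg; case: ifPn => mo; first lra.
  by rewrite -subn1 natrB//; lra.
have mg0 : 0 < mg by rewrite mulr_gt0 ?ltr0n//; case/andP: g01.
have cB : 0 < cos B by rewrite cos_gt0_pihalf.
have h0 : 0 < r * cos mg by rewrite mulr_gt0// cos_gt0_acute// ltW.
have : R0 <= enorm (q k.+1) <= R1.
  apply: plate => //; rewrite qE /bside kodd.
  by exists (r * cos mg / cos B) => //; rewrite divr_gt0.
rewrite qE enorm_polar; last by rewrite divr_ge0// ltW.
rewrite ler_pdivlMr// ler_pdivrMr// => /andP[lo hi].
have cgB : cos gamma <= cos B.
  rewrite -(cos_norm B); have [->//|ne] := eqVneq `|B| gamma.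
  have : `|B| < gamma by rewrite lt_neqAle ne.
  by move=> ?; rewrite ltW// ltr_cos// in_itv/= ?normr_ge0; lra.
rewrite (le_trans _ lo) ?ler_wpM2l//= (le_trans hi)// ler_piMr ?cos_le1//.
by have := le_trans (ltW h0) hi; rewrite pmulr_lge0.
Qed.

Lemma bounce_lengthE gamma (R0 R1 : R) m z :
  0 < gamma < pi / 2 -> (0 < m)%N -> 0 <= R0 ->
  bounce_domain gamma R0 R1 m z ->
  bounce_length gamma R0 R1 m z = 2 * z.1 * sin (m%:R * gamma).
Proof.
move=> g01 m0 R00 [z1 z2 [q pq]]; apply: xget_unique.
  by have [_ <- _] := plate_path_bounds _ _ _ _ _ _ _ g01 m0 R00 z1 z2 pq; exists q.
move=> l [q' pq' ->].
by have [_ -> _] := plate_path_bounds _ _ _ _ _ _ _ g01 m0 R00 z1 z2 pq'.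
Qed.

End DomainIntegral.

Section DomainIntegralBounds.
Context {R : realType}.
Implicit Types (gamma : R) (z : R * R).

Definition bounce_integral gamma (R0 R1 : R) (m : nat) : \bar R :=
  (\int[lebesgue_measure \x lebesgue_measure]_(z in bounce_domain gamma R0 R1 m)
     (1 / bounce_length gamma R0 R1 m z ^+ 4 * z.1)%:E)%E.

Lemma bounce_integrand_ge0 gamma (R0 R1 : R) m z :
  bounce_domain gamma R0 R1 m z ->
  0 <= 1 / bounce_length gamma R0 R1 m z ^+ 4 * z.1.
Proof.
case=> z0 _ _; rewrite mulr_ge0 ?(ltW z0)// mul1r invr_ge0.
by rewrite (exprM _ 2 2) sqr_ge0.
Qed.

Lemma bounce_integral_ge0 gamma (R0 R1 : R) m :
  (0 <= bounce_integral gamma R0 R1 m)%E.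
Proof. by apply: integral_ge0 => z Dz; rewrite lee_fin bounce_integrand_ge0. Qed.

Lemma bounce_integrandE gamma (R0 R1 : R) m z :
  0 < gamma < pi / 2 -> (0 < m)%N -> 0 <= R0 ->
  bounce_domain gamma R0 R1 m z ->
  1 / bounce_length gamma R0 R1 m z ^+ 4 * z.1 =
  (16 * z.1 ^+ 3 * sin (m%:R * gamma) ^+ 4)^-1.
Proof.
move=> g01 m0 R00 Dz; rewrite (bounce_lengthE _ _ _ _ _ g01)//.
case: Dz => z0 zb [q pq].
have [mgb _ _] := plate_path_bounds _ _ _ _ _ _ _ g01 m0 R00 z0 zb pq.
have s0 : 0 < sin (m%:R * gamma).
  by rewrite sin_gt0_pihalf// mgb andbT mulr_gt0 ?ltr0n//; case/andP: g01.
by field; rewrite !lt0r_neq0.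
Qed.

(** By [plate_path_bounds] the domain lies in a rectangle of width
    (R1 - R0 cos gamma) / cos (m gamma), on which the integrand is largest at
    the inner edge. The factor cos^2 / sin^4 of m gamma that results is at
    most (m gamma)^-4, which makes the bound summable over m with no
    truncation; for m gamma >= pi / 2 the domain is empty. *)
Lemma bounce_integral_le gamma (R0 R1 : R) m :
  0 < gamma < pi / 2 -> (0 < m)%N -> 0 < R0 -> R0 <= R1 ->
  (bounce_integral gamma R0 R1 m <= (gamma * (R1 - R0 * cos gamma) /
     (16 * (R0 * cos gamma) ^+ 3 * (m%:R * gamma) ^+ 4))%:E)%E.
Proof.
move=> g01 m0 R00 R01; set mg := m%:R * gamma.
have [g0 gpi] := andP g01.
have cg : 0 < cos gamma by rewrite cos_gt0_acute// ltW.
have mg0 : 0 < mg by rewrite mulr_gt0 ?ltr0n.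
have Rcg : R0 * cos gamma <= R1.
  by rewrite (le_trans _ R01)// ler_piMr ?cos_le1// ltW.
have Rcg0 : 0 < R0 * cos gamma by rewrite mulr_gt0.
have den0 : 0 < 16 * (R0 * cos gamma) ^+ 3 * mg ^+ 4.
  by rewrite !mulr_gt0 ?exprn_gt0 ?ltr0n.
have [mgb|mgb] := ltP mg (pi / 2); last first.
  rewrite /bounce_integral (_ : bounce_domain _ _ _ _ = set0).
    by rewrite integral_set0 lee_fin divr_ge0 ?(ltW den0)// mulr_ge0 ?subr_ge0// ltW.
  apply/seteqP; split=> // z [z0 zb [q pq]].
  have [] := plate_path_bounds _ _ _ _ _ _ _ g01 m0 (ltW R00) z0 zb pq.
  by rewrite ltNge mgb.
have c0 : 0 < cos mg by rewrite cos_gt0_acute// ltW.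
have s0 : 0 < sin mg by rewrite sin_gt0_pihalf// mg0.
have [a aE] : exists a, a = R0 * cos gamma / cos mg by eexists.
have a0 : 0 < a by rewrite aE divr_gt0.
pose b := R1 / cos mg.
have ab : a <= b by rewrite aE ler_pM2r ?invr_gt0.
pose M := (16 * a ^+ 3 * sin mg ^+ 4)^-1.
have M0 : 0 <= M.
  have a3 := exprn_gt0 3 a0; have s4 := exprn_gt0 4 s0.
  by rewrite invr_ge0 mulr_ge0 ?(ltW s4)// mulr_ge0 ?(ltW a3) ?ler0n.
apply: (@le_trans _ _ (M%:E * (((b - a) * gamma)%:E))%E).
  rewrite -measure_polar_box//; apply: integral_le_cst => //.
  - exact: measurable_polar_box.
  - move=> z [z0 zb [q pq]]; split=> /=; rewrite in_itv//=.
    have [_ _] := plate_path_bounds _ _ _ _ _ _ _ g01 m0 (ltW R00) z0 zb pq.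
    by rewrite -/mg aE /b ler_pdivrMr// ler_pdivlMr.
  - move=> z Dz; rewrite bounce_integrand_ge0//=.
    rewrite bounce_integrandE// ?(ltW R00)//; case: Dz => z0 zb [q pq].
    have [_ _ /andP[az _]] := plate_path_bounds _ _ _ _ _ _ _ g01 m0 (ltW R00) z0 zb pq.
    have {}az : a <= z.1 by rewrite aE ler_pdivrMr.
    rewrite lef_pV2 ?posrE ?mulr_gt0 ?exprn_gt0 ?ltr0n//.
    by rewrite ler_pM2r ?exprn_gt0// ler_pM2l// lerXn2r// nnegrE ltW.
rewrite -EFinM lee_fin.
rewrite [leLHS](_ : _ = gamma * (R1 - R0 * cos gamma) /
    (16 * (R0 * cos gamma) ^+ 3) * (cos mg ^+ 2 / sin mg ^+ 4)); last first.
  by rewrite /M aE /b; field; rewrite !lt0r_neq0.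
rewrite [leRHS](_ : _ = gamma * (R1 - R0 * cos gamma) /
    (16 * (R0 * cos gamma) ^+ 3) * mg ^- 4); last first.
  by field; rewrite !lt0r_neq0.
rewrite ler_wpM2l ?divr_ge0 ?mulr_ge0 ?subr_ge0 ?exprn_ge0 ?ler0n
  ?(ltW g0) ?(ltW R00) ?(ltW cg)//.
have /andP[lo _] : sin mg ^- 4 - sin mg ^- 2 <= mg ^- 4 <= sin mg ^- 4.
  by rewrite invr_pow4_csc// mg0.
rewrite (_ : cos mg ^+ 2 / _ = sin mg ^- 4 - sin mg ^- 2)// cos2sin2.
by field; rewrite lt0r_neq0.
Qed.

(** By [billiard_path_plate] the domain contains the rectangle
    R0 / cos (m gamma) <= r <= R1, on which the integrand is smallest at the
    outer edge. If that rectangle is empty, the bound is negative. *)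
Lemma bounce_integral_ge gamma (R0 R1 : R) m :
  0 < gamma < pi / 2 -> (0 < m)%N -> 0 < R0 -> R0 <= R1 ->
  m%:R * gamma < pi / 2 ->
  ((gamma * (R1 - R0 / cos (m%:R * gamma)) /
     (16 * R1 ^+ 3 * (m%:R * gamma) ^+ 4))%:E <= bounce_integral gamma R0 R1 m)%E.
Proof.
move=> g01 m0 R00 R01; set mg := m%:R * gamma => mgb.
have [g0 gpi] := andP g01.
have mg0 : 0 < mg by rewrite mulr_gt0 ?ltr0n.
have R10 : 0 < R1 := lt_le_trans R00 R01.
have den0 : 0 < 16 * R1 ^+ 3 * mg ^+ 4 by rewrite !mulr_gt0 ?exprn_gt0 ?ltr0n.
have c0 : 0 < cos mg by rewrite cos_gt0_acute// ltW.
have s0 : 0 < sin mg by rewrite sin_gt0_pihalf// mg0.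
pose a := R0 / cos mg; have a0 : 0 < a by rewrite divr_gt0.
rewrite -/a; have [aR|Ra] := leP a R1; last first.
  apply: le_trans (bounce_integral_ge0 _ _ _ _); rewrite lee_fin.
  by rewrite pmulr_lle0 ?invr_gt0// pmulr_rle0// subr_le0 ltW.
have sub : polar_box gamma a R1 `<=` bounce_domain gamma R0 R1 m.
  move=> z []; rewrite /= !in_itv/= => /andP[za zR] zb.
  have z0 : 0 < z.1 := lt_le_trans a0 za.
  have [zb1 zb2] := andP zb; split=> //.
  exists (billiard_path gamma m z.1 z.2); apply: billiard_path_plate => //.
  by rewrite -ler_pdivrMr.
pose M := (16 * R1 ^+ 3 * sin mg ^+ 4)^-1.
have M0 : 0 <= M.
  by rewrite invr_ge0 !mulr_ge0 ?exprn_ge0 ?ler0n ?(ltW R10) ?(ltW s0).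
apply: (@le_trans _ _ (M%:E * (((R1 - a) * gamma)%:E))%E); last first.
  rewrite -measure_polar_box//; apply: cst_le_integral => //.
  - exact: measurable_polar_box.
  - by move=> z; exact: bounce_integrand_ge0.
  - move=> z Ez; rewrite bounce_integrandE ?(ltW R00)//; last exact: sub.
    case: Ez; rewrite /= !in_itv/= => /andP[za zR] _.
    have z0 : 0 < z.1 := lt_le_trans a0 za.
    rewrite lef_pV2 ?posrE ?mulr_gt0 ?exprn_gt0 ?ltr0n//.
    by rewrite ler_pM2r ?exprn_gt0// ler_pM2l// lerXn2r// nnegrE ltW.
rewrite -EFinM lee_fin.
rewrite [leRHS](_ : _ = gamma * (R1 - a) / (16 * R1 ^+ 3) * sin mg ^- 4).
rewrite [leLHS](_ : _ = gamma * (R1 - a) / (16 * R1 ^+ 3) * mg ^- 4).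
- rewrite ler_wpM2l ?divr_ge0 ?mulr_ge0 ?subr_ge0 ?exprn_ge0 ?ler0n ?(ltW g0) ?(ltW R10)//.
  have /andP[//] : sin mg ^- 4 - sin mg ^- 2 <= mg ^- 4 <= sin mg ^- 4.
  by rewrite invr_pow4_csc// mg0.
- by field; rewrite !lt0r_neq0.
- by rewrite /M; field; rewrite !lt0r_neq0.
Qed.

End DomainIntegralBounds.

(** * Limits at zero *)

Section Limits.
Context {R : realType}.
Implicit Types (b c e g k l x : R).

(** Works at the level of extended reals, where neither the convergence of the
    series nor that of the integrals is known beforehand. *)
Lemma ereal_squeeze T (F : set_system T) (FF : ProperFilter F)
    (f : T -> \bar R) l :
  (forall e, 0 < e -> \forall t \near F, ((l - e)%:E <= f t <= (l + e)%:E)%E) ->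
  f @ F --> l%:E.
Proof.
move=> h; apply/fine_cvgP; split.
  near=> t; have /andP[lo hi] : ((l - 1)%:E <= f t <= (l + 1)%:E)%E.
    by near: t; exact: h.
  by rewrite fin_numE; apply/andP; split; apply/eqP => ft; move: lo hi; rewrite ft.
apply/cvgrPdist_le => e e0; near=> t.
have /andP[] : ((l - e)%:E <= f t <= (l + e)%:E)%E by near: t; exact: h.
rewrite /=; case: (f t) => [r| |]//=; rewrite !lee_fin => lo hi.
by rewrite ler_norml; lra.
Unshelve. all: by end_near. Qed.

Lemma cvg_id0 : (fun g : R => g) @ 0^'+ --> 0.
Proof. exact: cvg_at_right_filter (@cvg_id _ _). Qed.

Lemma cvg_sin0 : sin g @[g --> (0 : R)^'+] --> (0 : R).
Proof.
rewrite -[X in _ --> X]sin0; apply: cvg_at_right_filter.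
exact: continuous_sin.
Qed.

Lemma cvg_cosM k : cos (k * g) @[g --> (0 : R)^'+] --> (1 : R).
Proof.
have -> : 1 = cos (k * 0) :> R by rewrite mulr0 cos0.
apply: cvg_at_right_filter.
apply: (@continuous_comp _ _ _ ( *%R k) cos); first exact: mulrl_continuous.
exact: continuous_cos.
Qed.

Lemma cvg_sin_div : sin g / g @[g --> (0 : R)^'+] --> (1 : R).
Proof.
have c := cvg_cosM 1.
apply: (@squeeze_cvgr _ _ _ R (fun g => cos (1 * g)) (fun=> 1));
  [|exact: c|exact: cvg_cst].
near=> g; have g0 : 0 < g by [].
have gp : g < pi / 2 by near: g; apply: nbhs_right_lt; rewrite divr_gt0// pi_gt0.
have /andP[? ?] : g * cos g <= sin g <= g by apply: sin_mean_value; lra.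
by rewrite mul1r ler_pdivlMr// ler_pdivrMr// mul1r mulrC; apply/andP.
Unshelve. all: by end_near. Qed.

Lemma cvg_one_sub_cos_div k : 0 <= k ->
  (1 - cos (k * g)) / g @[g --> (0 : R)^'+] --> (0 : R).
Proof.
move=> k0.
have c : k ^+ 2 / 2 * g @[g --> (0 : R)^'+] --> (0 : R).
  by rewrite -[X in _ --> X](mulr0 (k ^+ 2 / 2)); apply: cvgMl_tmp; exact: cvg_id0.
apply: (@squeeze_cvgr _ _ _ R (fun=> 0) (fun g => k ^+ 2 / 2 * g));
  [|exact: cvg_cst|exact: c].
have kp : 0 < k + 1 by lra.
have bnd : 0 < pi / 2 / (k + 1) by rewrite ltr_pdivlMr// mul0r divr_gt0// pi_gt0.
near=> g; have g0 : 0 < g by [].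
have kg : k * g <= pi / 2.
  have : g < pi / 2 / (k + 1) by near: g; exact: nbhs_right_lt.
  by rewrite ltr_pdivlMr//; nra.
have kg0 : 0 <= k * g by rewrite mulr_ge0// ltW.
have := cos_ge_parabola (k * g); rewrite kg0 kg => /(_ isT) cp.
rewrite divr_ge0 ?subr_ge0 ?cos_le1 ?(ltW g0)//= ler_pdivrMr//.
by move: cp; rewrite exprMn; lra.
Unshelve. all: by end_near. Qed.

End Limits.

(** * The parallel plate limit *)

Section ParallelPlateLimit.
Context {R : realType}.
Variables (L b : R).
Hypotheses (L_gt0 : 0 < L) (b_gt0 : 0 < b).
Implicit Types (g : R) (m : nat).

(** m^4 times the bound of [bounce_integral_le] for R0 = L / sin g and R1 = R0
    + b, written in terms of quotients that have a limit at 0. *)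
Definition upper_ratio g : R :=
  (b + L * ((1 - cos (1 * g)) / g) / (sin g / g)) * (sin g / g) ^+ 3
    / (16 * L ^+ 3 * cos (1 * g) ^+ 3).

(** m^4 times the bound of [bounce_integral_ge], in the same form. Here the
    dependence on m remains, so the limit is only taken term by term. *)
Definition lower_ratio m g : R :=
  (b - L * ((1 - cos (m%:R * g)) / g) / (sin g / g) / cos (m%:R * g))
    * (sin g / g) ^+ 3 / (16 * (L + b * sin g) ^+ 3).

Lemma cvg_cube (F : set_system R) (f : R -> R) (a : R) : Filter F ->
  f x @[x --> F] --> a -> f x ^+ 3 @[x --> F] --> a ^+ 3.
Proof.
move=> FF fa; have E x : x ^+ 3 = x * x * x :> R by rewrite !exprS expr0 mulr1 mulrA.
by rewrite E; under eq_fun do rewrite E; apply: cvgM => //; exact: cvgM.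
Qed.

Lemma cvg_upper_ratio :
  upper_ratio g @[g --> (0 : R)^'+] --> b / (16 * L ^+ 3).
Proof.
rewrite /upper_ratio.
have -> : b / (16 * L ^+ 3) =
    (b + L * 0 / 1) * 1 ^+ 3 / (16 * L ^+ 3 * 1 ^+ 3).
  by field; rewrite lt0r_neq0.
have L16 : 16 * L ^+ 3 * 1 ^+ 3 != 0 :> R.
  by rewrite expr1n mulr1 mulf_neq0// lt0r_neq0// exprn_gt0.
apply: cvgM; last first.
  apply: cvgV => //; apply: cvgMl_tmp.
  by apply: cvg_cube; exact: cvg_cosM.
apply: cvgM; last by apply: cvg_cube; exact: cvg_sin_div.
apply: cvgD; first exact: cvg_cst.
apply: cvgM; first by apply: cvgMl_tmp; exact: cvg_one_sub_cos_div.
by apply: cvgV; [exact: oner_neq0|exact: cvg_sin_div].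
Qed.

Lemma cvg_lower_ratio m :
  lower_ratio m g @[g --> (0 : R)^'+] --> b / (16 * L ^+ 3).
Proof.
rewrite /lower_ratio.
have -> : b / (16 * L ^+ 3) =
    (b - L * 0 / 1 / 1) * 1 ^+ 3 / (16 * (L + b * 0) ^+ 3).
  by field; rewrite ?mulr0 ?addr0 lt0r_neq0.
have L16 : 16 * (L + b * 0) ^+ 3 != 0 :> R.
  by rewrite mulr0 addr0 mulf_neq0// lt0r_neq0// exprn_gt0.
apply: cvgM; last first.
  apply: cvgV => //; apply: cvgMl_tmp; apply: cvg_cube.
  by apply: cvgD; [exact: cvg_cst|apply: cvgMl_tmp; exact: cvg_sin0].
apply: cvgM; last by apply: cvg_cube; exact: cvg_sin_div.
apply: cvgB; first exact: cvg_cst.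
apply: cvgM; last by apply: cvgV; [exact: oner_neq0|exact: cvg_cosM].
apply: cvgM; first by apply: cvgMl_tmp; exact: cvg_one_sub_cos_div.
by apply: cvgV; [exact: oner_neq0|exact: cvg_sin_div].
Qed.

Lemma bounce_integral_le_ratio g m : 0 < g < pi / 2 -> (0 < m)%N ->
  (bounce_integral g (L / sin g) (L / sin g + b) m <=
   (upper_ratio g * m%:R ^- 4)%:E)%E.
Proof.
move=> g01 m0; have [g0 _] := andP g01.
have s0 := sin_gt0_pihalf g01.
have c0 : 0 < cos g by apply: cos_gt0_acute; lra.
have mR : 0 < m%:R :> R by rewrite ltr0n.
apply: le_trans (bounce_integral_le _ _ _ _ g01 m0 _ _) _.
- by rewrite divr_gt0.
- by rewrite lerDl ltW.
rewrite lee_fin le_eqVlt; apply/orP; left; apply/eqP.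
by rewrite /upper_ratio mul1r; field; rewrite !lt0r_neq0.
Qed.

Lemma bounce_integral_ge_ratio g m : 0 < g < pi / 2 -> (0 < m)%N ->
  m%:R * g < pi / 2 ->
  ((lower_ratio m g * m%:R ^- 4)%:E <=
   bounce_integral g (L / sin g) (L / sin g + b) m)%E.
Proof.
move=> g01 m0 mg; have [g0 _] := andP g01.
have s0 := sin_gt0_pihalf g01.
have mR : 0 < m%:R :> R by rewrite ltr0n.
have c0 : 0 < cos (m%:R * g) by rewrite cos_gt0_acute// mulr_ge0 ?ltW.
apply: le_trans (bounce_integral_ge _ _ _ _ g01 m0 _ _ mg).
- rewrite lee_fin le_eqVlt; apply/orP; left; apply/eqP.
  have Lb : 0 < L + b * sin g by rewrite addr_gt0// mulr_gt0.
  by rewrite /lower_ratio; field; rewrite !lt0r_neq0//= addrC.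
- by rewrite divr_gt0.
- by rewrite lerDl ltW.
Qed.

(** The upper bound sums exactly to a multiple of the partial sums of zeta(4).
    For the lower bound, a finite partial sum close to zeta(4) is enough, as
    the terms are nonnegative. *)
Lemma cvg_bounce_series (W : R) (k := 2 * W * (b / (16 * L ^+ 3))) : 0 < W ->
  (\sum_(1 <= m <oo) (2 * W)%:E *
     bounce_integral g (L / sin g) (L / sin g + b) m)%E @[g --> (0 : R)^'+]
  --> (k * (pi ^+ 4 / 90))%:E.
Proof.
move=> W0; have W2 : 0 <= 2 * W by rewrite mulr_ge0// ltW.
have term0 g m : (0 <= (2 * W)%:E *
    bounce_integral g (L / sin g) (L / sin g + b) m)%E.
  by rewrite mule_ge0// bounce_integral_ge0.
have p0 : 0 < pi / 2 :> R by rewrite divr_gt0// pi_gt0.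
have k0 : 0 < k by rewrite !mulr_gt0// invr_gt0 !mulr_gt0// ltr0n.
apply: ereal_squeeze => e e0.
(* half of e is spent on truncating the series, half on the limit of the sum *)
have ek : 0 < e / 2 / k by rewrite !divr_gt0.
have [n zn] := zeta4_sum_ge (e / 2 / k) ek.
have kz : k * (pi ^+ 4 / 90) - e / 2 <= k * zeta4_sum n.
  rewrite -(ler_pM2l k0) mulrBr in zn; apply: le_trans zn.
  by rewrite (_ : k * (e / 2 / k) = e / 2)// mulrC divfK// lt0r_neq0.
have e20 : 0 < e / 2 by rewrite divr_gt0.
have n0 : 0 < pi / 2 / n.+1%:R :> R by rewrite divr_gt0.
pose lower g := \sum_(1 <= m < n) 2 * W * lower_ratio m g * m%:R ^- 4.
have clower : lower g @[g --> (0 : R)^'+] --> k * zeta4_sum n.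
  rewrite /lower /zeta4_sum big_distrr/=.
  apply: (@cvg_big R nat +%R 0 xpredT (@add_continuous R) R _ (index_iota 1 n)
    (fun m g => 2 * W * lower_ratio m g * m%:R ^- 4) (fun m => k * m%:R ^- 4)
    (at_right_proper_filter 0)) => m _.
  by apply: cvgMr_tmp; apply: cvgMl_tmp; exact: cvg_lower_ratio.
near=> g.
have g01 : 0 < g < pi / 2 by apply/andP; split => //; near: g; exact: nbhs_right_lt.
apply/andP; split; last first.
  have up : 2 * W * upper_ratio g * (pi ^+ 4 / 90) <= k * (pi ^+ 4 / 90) + e.
    near: g.
    have c : 2 * W * upper_ratio g * (pi ^+ 4 / 90) @[g --> (0 : R)^'+] -->
        k * (pi ^+ 4 / 90).
      by apply: cvgMr_tmp; apply: cvgMl_tmp; exact: cvg_upper_ratio.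
    have /cvgrPdist_le /(_ _ e0) := c; apply: filterS => g.
    by rewrite ler_norml => ?; lra.
  apply: le_trans (_ : _ <= (2 * W * upper_ratio g * (pi ^+ 4 / 90))%:E)%E _.
    apply: lime_le; first by apply: is_cvg_nneseries => *; exact: term0.
    near=> j.
    apply: (@le_trans _ _ (\sum_(1 <= m < j)
        (2 * W * upper_ratio g * m%:R ^- 4)%:E)%E).
      rewrite big_nat_cond [leRHS]big_nat_cond; apply: lee_sum => m.
      rewrite andbT => /andP[m1 _]; rewrite -(mulrA (2 * W)) [leRHS]EFinM.
      by rewrite lee_wpmul2l// bounce_integral_le_ratio.
    rewrite sumEFin lee_fin -big_distrr/= ler_wpM2l//; last exact: zeta4_sum_le.
    rewrite mulr_ge0// -(pmulr_lge0 _ (_ : 0 < (1%:R : R) ^- 4)) ?invr_gt0 ?exprn_gt0//.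
    rewrite -lee_fin (le_trans _ (bounce_integral_le_ratio g 1 g01 isT))//.
    exact: bounce_integral_ge0.
  by rewrite lee_fin.
have lo : k * (pi ^+ 4 / 90) - e <= lower g.
  have dist : `|k * zeta4_sum n - lower g| <= e / 2.
    near: g.
    by have /cvgrPdist_le /(_ _ e20) := clower.
  by clear -dist kz; move: dist; rewrite ler_norml => ?; lra.
apply: (@le_trans _ _ (lower g)%:E); first by rewrite lee_fin.
apply: le_trans (nneseries_lim_ge n _) => [|m _ _]; last exact: term0.
rewrite -sumEFin big_nat_cond [leRHS]big_nat_cond; apply: lee_sum => m.
rewrite andbT => /andP[m1 mn]; rewrite -(mulrA (2 * W)) [leLHS]EFinM.
rewrite lee_wpmul2l// bounce_integral_ge_ratio//.
have gn : g < pi / 2 / n.+1%:R by near: g; exact: nbhs_right_lt.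
move: gn; rewrite ltr_pdivlMr// mulrC; apply: le_lt_trans.
by have [/ltW g0 _] := andP g01; rewrite ler_wpM2r// ler_nat leqW// ltnW.
Unshelve. all: by end_near. Qed.

End ParallelPlateLimit.

Theorem theorem3 (R : realType) (hbar c L b W : R)
  (hbar_gt0 : 0 < hbar) (c_gt0 : 0 < c)
  (L_gt0 : 0 < L) (b_gt0 : 0 < b) (W_gt0 : 0 < W) :
  let A := b * W in
  casimir_energy hbar c L b W gamma @[gamma --> 0^'+] -->
    (- (hbar * c * pi ^+ 2 * A / (1440 * L ^+ 3)))%:E.
Proof.
move=> A; rewrite /casimir_energy /=.
have -> : - (hbar * c * pi ^+ 2 * A / (1440 * L ^+ 3)) =
    - (hbar * c / (2 * pi ^+ 2)) *
    (2 * W * (b / (16 * L ^+ 3)) * (pi ^+ 4 / 90)).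
  have := pi_gt0 R; rewrite /A; move: (pi : R) => p p0.
  by field; rewrite !lt0r_neq0.
rewrite EFinM.
have lim := cvg_bounce_series L b L_gt0 b_gt0 W W_gt0.
exact: (cvgeZl (isT : (- (hbar * c / (2 * pi ^+ 2)))%:E \is a fin_num) lim).
Qed.
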